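(* For any integer $d\ge 0$ and any complex numbers $z_0,z_1,\ldots,z_d$ with $|z_j|<1$, $j=0,1,\ldots,d$, we have $$\sum_{a_0,\ldots,a_d\ge 0}\zeta^{\star}(\{2\}^{a_0+1},1,\{2\}^{a_1},\ldots,1,\{2\}^{a_d})\,z_0^{2a_0}\cdots z_d^{2a_d}=-\sum_{k_0\ge\cdots\ge k_d\ge 1}\frac{(-1)^{k_d}k_d}{k_0^2}\,\prod_{i=0}^d\frac{k_i\cdot 2^{\Delta(k_{i-1},k_i)}}{k_i^2-z_i^2}$$ (the argument of $\zeta^\star$ contains exactly $d$ entries equal to $1$) and $$\sum_{a_0,\ldots,a_d\ge 0}\zeta^{\star}(\{2\}^{a_0+1},1,\{2\}^{a_1},\ldots,1,\{2\}^{a_d},1)\,z_0^{2a_0}\cdots z_d^{2a_d}=\sum_{k_0\ge\cdots\ge k_d\ge 1}\frac{1}{k_0^2}\,\prod_{i=0}^d\frac{k_i\cdot 2^{\Delta(k_{i-1},k_i)}}{k_i^2-z_i^2}$$ (the argument of $\zeta^\star$ contains exactly $d+1$ entries equal to $1$), where $k_{-1}=0$.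
   Context: For positive integers $s_1,\ldots,s_m$ with $s_1\ge 2$, the multiple zeta star value is $\zeta^\star(s_1,\ldots,s_m)=\sum_{k_1\ge\cdots\ge k_m\ge 1}\frac{1}{k_1^{s_1}\cdots k_m^{s_m}}$ (sum over positive integers), and $\zeta^\star(\emptyset)=1$. $\{2\}^a$ denotes the sequence consisting of $a$ copies of $2$ (empty if $a=0$). $\Delta(a,b)=0$ if $a=b$ and $\Delta(a,b)=1$ otherwise. In all sums the indices $a_i,k_i$ are integers, and $0^0=1$ in power series. *)

(* Defs.v *)
From mathcomp Require Import all_boot all_order all_algebra finmap complex.
From mathcomp Require Import all_classical all_reals all_analysis.
From mathcomp.analysis.showcase Require summability.

Set Implicit Arguments.
Unset Strict Implicit.
Unset Printing Implicit Defensive.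
Import Order.TTheory GRing.Theory Num.Theory.
Import numFieldNormedType.Exports.
Local Open Scope classical_set_scope.
Local Open Scope ring_scope.

Section UnorderedSum.
Context {I : choiceType} {K : numFieldType}.
Implicit Types (P : pred I) (f : I -> K).

Definition finite_sums P f : {fset I} -> K :=
  fun A => \sum_(i <- A | P i) f i.

(* Unordered summation: the limit of the finite sums along the directed set of
   finite subsets of I.  Over the complex numbers, convergence in this sense
   is equivalent to absolute convergence. *)
Definition usummable P f := cvg (finite_sums P f @ summability.totally).

Definition usum P f : K := lim (finite_sums P f @ summability.totally).

End UnorderedSum.

(* k_1 >= ... >= k_m >= 1 *)
Definition pos_chain (k : seq nat) : bool := sorted geq k && all (leq 1) k.

(* For s_1 >= 2 the sum is finite; [fine] sends a divergent one to 0.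
   For s = [::] the only index is the empty tuple, and the value is 1. *)
Definition zeta_star (R : realType) (s : seq nat) : R :=
  fine (\esum_(k in [set k : (size s).-tuple nat | pos_chain k])
    (\prod_(i < size s) ((tnth k i)%:R ^+ nth 0%N s i)^-1)%:E)%R.

(* {2}^(a_0+1), 1, {2}^(a_1), ..., 1, {2}^(a_d) *)
Definition two_one_word d (a : d.+1.-tuple nat) : seq nat :=
  nseq (thead a).+1 2%N ++ flatten [seq 1%N :: nseq b 2%N | b <- behead a].

Definition Delta (a b : nat) : nat := if a == b then 0%N else 1%N.

(* [nth 0 (0 :: k) i] is k_(i-1), with k_(-1) = 0. *)
Definition kernel_prod (R : realType) d (z : 'I_d.+1 -> R[i])
    (k : d.+1.-tuple nat) : R[i] :=
  \prod_(i < d.+1)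
    ((tnth k i)%:R * 2 ^+ Delta (nth 0%N (0%N :: k) i) (tnth k i)
      / ((tnth k i)%:R ^+ 2 - z i ^+ 2)).

(* Main.v *)
Require Import Defs.
From mathcomp Require Import all_boot all_order all_algebra finmap complex.
From mathcomp Require Import all_classical all_reals all_analysis.
From mathcomp.analysis.showcase Require summability.
From mathcomp Require Import ring lra zify.
Import Order.TTheory GRing.Theory Num.Theory.
Import numFieldNormedType.Exports.
Set Implicit Arguments.
Unset Strict Implicit.
Unset Printing Implicit Defensive.

(** Write [c_n(k) = n!^2 / ((n - k)! (n + k)!)] and let [S_n(s)] be the partial
sum of the multiple zeta star value of [s] over the chains with entries at most
[n].  As functions of [n], the [c_n(k)] with [k > 0] are eigenvectors of putting
a 2 in front of a word, the operator [f |-> (n |-> \sum_(j <= n) f j / j^2)],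
with eigenvalue [1 / k^2] ([sum_binratio_sqr]).  Putting a 1 in front, the
operator [f |-> (n |-> \sum_(j <= n) f j / j)], sends [c_n(k)] to
[c_n(k) / k + 2 * \sum_(m > k) c_n(m) / m] ([sum_binratio_inv]): this is where
the factors [2 ^ Delta] come from.  The empty word, that is the constant
function 1, is [- 2 * \sum_(k > 0) (-1)^k c_n(k)] for [n > 0]
([sum_alt_binratio]), and the word 1 is [2 * \sum_(k > 0) c_n(k) / k].
Building a word letter by letter from one of these two seeds therefore expands
[S_n] exactly, for each [n > 0]:

  [S_n({2}^(a_0+1), 1, {2}^(a_1), ...) =
     \sum_(n >= k_0 >= ... >= k_d >= 1) c_n(k_0) * T_a(k_0, ..., k_d)]

where [T_a(k)] is, up to the seed factor [e(k_d)] and [1 / k_0^2], the product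
of the [k_i * 2 ^ Delta(k_(i-1), k_i) / k_i ^ (2 * a_i + 2)]
([star_sum_blocks], [sum_binratio_term]).

Now let [n] grow.  Since [0 <= c_n(k) <= 1] and [c_n(k)] tends to 1, and since
[|T_a(k)| <= 2^(d+1) * k_d / (k_0^2 * k_0 ... k_d)], dominated convergence
([tannery]) gives [zeta_star = \sum_k T_a(k)].  The dominating family is
summable because summing [k_d * \prod_i 1 / k_i] over the chains below [n]
telescopes to [n], which leaves [\sum 1 / k_0^2] ([sum_majorant_le2]).

Finally multiply by [\prod_j z_j ^ (2 * a_j)] and consider the double family
over [a] and [k].  It is dominated by a product of a summable family in [k]
and geometric series in [a], hence summable, and its sum may be computed in
either order ([has_sum_fubini]).  Summing over [k] first gives the generating
function of the zeta star values; summing over [a] first, a product of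
geometric series turns each [1 / k_i^(2 * a_i + 2)] into
[1 / (k_i^2 - z_i^2)].  The two formulas are the two seeds. *)

Local Open Scope classical_set_scope.
Local Open Scope ring_scope.
Local Open Scope complex_scope.

(** * The ratios of binomial coefficients C(2n, n - k) / C(2n, n) *)

Section BinomialRatios.
Variable R : realType.

(** This is [n!^2 / ((n - k)! (n + k)!)]; the truncated subtraction makes it
vanish for [k > n], so sums over [k] may be cut at any bound beyond [n]. *)
Fixpoint binratio (n k : nat) : R :=
  if k is k'.+1 then binratio n k' * ((n - k')%N%:R / (n + k)%N%:R) else 1.

Lemma binratio_eq0 n k : (n < k)%N -> binratio n k = 0.
Proof.
elim: k => [//|k IH]; rewrite ltnS leq_eqVlt => /orP[/eqP ->|/IH /= ->].
  by rewrite /= subnn mul0r mulr0.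
by rewrite mul0r.
Qed.

Lemma binratio_ge0 n k : 0 <= binratio n k.
Proof. by elim: k => //= k IH; rewrite mulr_ge0 ?divr_ge0. Qed.

Lemma binratio_le1 n k : binratio n k <= 1.
Proof.
elim: k => //= k IH; rewrite mulr_ile1 ?binratio_ge0 ?divr_ge0 //.
by rewrite ler_pdivrMr ?ltr0n ?addnS// mul1r ler_nat; lia.
Qed.

(** Each step from [k] to [k + 1] multiplies by at least
[1 - (2 * k + 1) / (n + 1)], and the losses add up to [k^2 / (n + 1)]. *)
Lemma binratio_ge n k : 1 - k%:R ^+ 2 / n.+1%:R <= binratio n.+1 k.
Proof.
have n0 : 0 < n.+1%:R :> R by rewrite ltr0n.
elim: k => [|k IH /=]; first by rewrite expr0n /= mul0r subr0.
have qge : 1 - (2 * k%:R + 1) / n.+1%:R <= (n.+1 - k)%N%:R / (n.+1 + k.+1)%N%:R :> R.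
  have s0 : 0 < (n.+1 + k.+1)%N%:R :> R by rewrite ltr0n addnS.
  apply: (@le_trans _ _ (1 - (2 * k%:R + 1) / (n.+1 + k.+1)%N%:R)).
    rewrite lerD2l lerN2 ler_wpM2l ?lef_pV2 ?posrE ?ler_nat ?leq_addr//.
  rewrite -[X in X - _](mulfV (lt0r_neq0 s0)) -mulrBl ler_wpM2r ?invr_ge0 ?(ltW s0)//.
  have : (n.+1)%:R - k%:R <= (n.+1 - k)%N%:R :> R.
    case: (leqP k n.+1) => [le|lt]; first by rewrite natrB.
    rewrite (_ : (n.+1 - k)%N = 0%N); last by lia.
    by rewrite subr_le0 ler_nat ltnW.
  apply: le_trans; rewrite natrD -[k.+1]addn1 natrD; lra.
have := binratio_ge0 n.+1 k; have := binratio_le1 n.+1 k.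
set c := binratio _ _ in IH *; set q := _ / _ in qge * => c1 c0.
have t0 : 0 <= (2 * k%:R + 1) / n.+1%:R :> R.
  by rewrite divr_ge0 ?(ltW n0)// addr_ge0// mulr_ge0.
apply: (@le_trans _ _ (c * (1 - (2 * k%:R + 1) / n.+1%:R))); last by rewrite ler_wpM2l.
rewrite (_ : k.+1%:R ^+ 2 / n.+1%:R =
    k%:R ^+ 2 / n.+1%:R + (2 * k%:R + 1) / n.+1%:R :> R); last first.
  by rewrite -mulrDl; congr (_ / _); rewrite -addn1 natrD; ring.
set t := (_ + 1) / _ in t0 *; set v := _ / _ in IH *; nra.
Qed.

Lemma binratioS n k :
  binratio n.+1 k.+1 * (n.+1 + k.+1)%:R = binratio n.+1 k * (n.+1 - k)%N%:R.
Proof. by rewrite /= mulrA divfK // pnatr_eq0 addnS. Qed.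

Lemma binratio_pred n k :
  binratio n k * n.+1%:R ^+ 2 = binratio n.+1 k * (n.+1%:R ^+ 2 - k%:R ^+ 2).
Proof.
elim: k => [|k IH]; first by rewrite /= !mul1r expr0n subr0.
case: (ltngtP k n) => [lt||->]; last 2 first.
- by move=> lt; rewrite !binratio_eq0 ?mul0r//; lia.
- by rewrite subrr mulr0 binratio_eq0 ?mul0r.
rewrite /= !natrB; try lia.
have : (n + k.+1)%:R != 0 :> R by rewrite pnatr_eq0; lia.
have : (n.+1 + k.+1)%:R != 0 :> R by rewrite pnatr_eq0; lia.
move: IH; rewrite !natrD -!natr1 => IH h1 h2.
have -> : binratio n k * ((n%:R - k%:R) / (n%:R + (k%:R + 1))) * (n%:R + 1) ^+ 2 =
  (binratio n k * (n%:R + 1) ^+ 2) * ((n%:R - k%:R) / (n%:R + (k%:R + 1))) by ring.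
rewrite IH; field.
by rewrite h1 h2.
Qed.

(** By [binratio_pred], [c_n(k) - c_(n-1)(k) = c_n(k) * k^2 / n^2], so the sum
telescopes: the [c_n(k)] are eigenvectors of prefixing the letter 2. *)
Lemma sum_binratio_sqr n k : (0 < k)%N ->
  \sum_(1 <= j < n.+1) binratio j k / j%:R ^+ 2 = binratio n k / k%:R ^+ 2.
Proof.
move=> k0; elim: n => [|n IH].
  by rewrite big_nil binratio_eq0 // mul0r.
rewrite big_nat_recr //= IH.
have k1 : k%:R != 0 :> R by rewrite pnatr_eq0; lia.
have n1 : n.+1%:R != 0 :> R by rewrite pnatr_eq0.
have := binratio_pred n k => /(congr1 (fun x => x / (k%:R ^+ 2 * n.+1%:R ^+ 2))) h.
have -> : binratio n k / k%:R ^+ 2 =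
  binratio n k * n.+1%:R ^+ 2 / (k%:R ^+ 2 * n.+1%:R ^+ 2).
  by field; rewrite nat1r k1 n1.
by rewrite h; field; rewrite nat1r k1 n1.
Qed.

(** Telescoping in [m], with primitive [(n - m) * c_n(m)]. *)
Lemma sum_mul_binratio n k : (0 < n)%N ->
  2 * \sum_(k.+1 <= m < n.+1) m%:R * binratio n m = (n%:R - k%:R) * binratio n k.
Proof.
case: n => // n _.
case: (leqP k n.+1) => [kn|lt]; last first.
  by rewrite big_geq ?mulr0 ?binratio_eq0 ?mulr0//; lia.
have E m : (m <= n.+1)%N ->
  \sum_(m <= i < n.+1) 2 * (i.+1%:R * binratio n.+1 i.+1)
   = (n.+1%:R - m%:R) * binratio n.+1 m.
  move=> mn; transitivity (- \sum_(m <= i < n.+1)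
     ((n.+1%:R - i.+1%:R) * binratio n.+1 i.+1 - (n.+1%:R - i%:R) * binratio n.+1 i)).
    rewrite -sumrN; apply: eq_big_nat => i /andP[_ lti].
    have := binratioS n i; rewrite natrB; last by lia.
    by rewrite natrD => h; rewrite [(_ - i%:R) * _]mulrC -h; ring.
  by rewrite telescope_sumr// subrr mul0r sub0r opprK.
by rewrite -E // big_add1 /= mulr_sumr.
Qed.

(** Both sides have the same increment in [n]: the one on the right is
evaluated with [sum_mul_binratio].  The formula also holds for [k = 0], where
[c_n(0) = 1] and the first term vanishes because [0^-1 = 0]; that case expands
the harmonic numbers. *)
Lemma sum_binratio_inv n k :
  \sum_(1 <= j < n.+1) binratio j k / j%:R =
  binratio n k / k%:R + 2 * \sum_(k.+1 <= m < n.+1) binratio n m / m%:R.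
Proof.
elim: n => [|n IH].
  rewrite big_nil (big_geq (m := k.+1)) ?mulr0//.
  by rewrite addr0; case: k => [|k]; [rewrite invr0 mulr0 | rewrite binratio_eq0 // mul0r].
rewrite big_nat_recr //= IH.
have n1 : n.+1%:R != 0 :> R by rewrite pnatr_eq0.
have D m : binratio n m / m%:R =
    binratio n.+1 m / m%:R - m%:R * binratio n.+1 m / n.+1%:R ^+ 2.
  case: m => [|m]; first by rewrite invr0 !mulr0 !mul0r subr0.
  have m1 : m.+1%:R != 0 :> R by rewrite pnatr_eq0.
  have := binratio_pred n m.+1 => /(congr1 (fun x => x / (m.+1%:R * n.+1%:R ^+ 2))) h.
  have -> : binratio n m.+1 / m.+1%:R =
     binratio n m.+1 * n.+1%:R ^+ 2 / (m.+1%:R * n.+1%:R ^+ 2).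
    by field; rewrite !nat1r m1 n1.
  by rewrite h; field; rewrite !nat1r m1 n1.
have -> : \sum_(k.+1 <= m < n.+1) binratio n m / m%:R =
  \sum_(k.+1 <= m < n.+2) binratio n m / m%:R.
  case: (ltnP k n.+1) => h; first by
    rewrite [RHS]big_nat_recr// binratio_eq0// mul0r; exact: (esym (addr0 _)).
  by rewrite !big_geq//; lia.
under [in LHS]eq_bigr do rewrite D.
rewrite sumrB D -mulr_suml.
have := @sum_mul_binratio n.+1 k isT; set S := \sum_(_ <= _ < _) _ => h.
have -> : S = (n.+1%:R - k%:R) * binratio n.+1 k / 2 by rewrite -h; field.
set T := \sum_(_ <= _ < _) _.
suff : binratio n.+1 k / n.+1%:R =
  k%:R * binratio n.+1 k / n.+1%:R ^+ 2 + (n.+1%:R - k%:R) * binratio n.+1 k / n.+1%:R ^+ 2.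
  by move=> ->; set q := _ / k%:R; field; rewrite nat1r n1.
by field; rewrite nat1r n1.
Qed.

(** Half of the identity [(1 - 1)^(2 * n) = 0]; the half sum telescopes with
primitive [(-1)^k * c_n(k) * (n + k) / (2 * n)]. *)
Lemma sum_alt_binratio n : (0 < n)%N ->
  2 * \sum_(1 <= k < n.+1) (-1) ^+ k * binratio n k = -1.
Proof.
case: n => // n _.
have n1 : n.+1%:R != 0 :> R by rewrite pnatr_eq0.
pose D k := (-1) ^+ k * binratio n.+1 k * (n.+1%:R + k%:R) / n.+1%:R.
transitivity (- \sum_(1 <= k < n.+2) (D k.+1 - D k)).
  rewrite -sumrN mulr_sumr; apply: eq_big_nat => k /andP[_ kn]; rewrite /D.
  have := binratioS n k; rewrite natrB; last by lia.
  rewrite natrD exprS => h.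
  have -> : -1 * (-1) ^+ k * binratio n.+1 k.+1 * (n.+1%:R + k.+1%:R) / n.+1%:R
   = - (-1) ^+ k * (binratio n.+1 k * (n.+1%:R - k%:R)) / n.+1%:R.
    by rewrite -h; ring.
  by field; rewrite nat1r n1.
rewrite telescope_sumr // /D binratio_eq0 // mulr0 !mul0r sub0r opprK /=.
rewrite subn0 mul1r natrD; field.
have : (n.+1 + 1)%:R != 0 :> R by rewrite pnatr_eq0 addn1.
by rewrite nat1r natrD addrC n1 => ->.
Qed.

End BinomialRatios.

(** * Finite expansions of multiple harmonic star sums *)

Section FiniteIdentity.
Variable R : realType.
Local Notation binratio := (@binratio R).

Lemma exchange_triangle (F : nat -> nat -> R) n :
  \sum_(1 <= i < n.+1) \sum_(1 <= j < i.+1) F i j =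
  \sum_(1 <= j < n.+1) \sum_(j <= i < n.+1) F i j.
Proof.
elim: n => [|n IH]; first by rewrite !big_nil.
rewrite big_nat_recr //= IH [RHS]big_nat_recr //= [in RHS]big_nat1.
rewrite [X in _ + X = _]big_nat_recr //= addrA; congr (_ + _).
rewrite -big_split /=; apply: eq_big_nat => j /andP[_ jn].
by rewrite [RHS]big_nat_recr ?(ltnW jn).
Qed.

(** The partial multiple zeta star sum over the chains with entries at most
[n]. *)
Fixpoint star_sum (n : nat) (s : seq nat) : R :=
  if s is x :: s' then
    \sum_(1 <= k < n.+1) (k%:R ^+ x)^-1 * star_sum k s'
  else 1.

(** The seed: the word at the end of all others is supposed to expand as
[\sum_k c_n(k) * 2 / k * eps k]. *)
Variable eps : nat -> R.

Fixpoint inner_sum (bs : seq nat) (j : nat) : R :=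
  if bs is b :: bs' then
    \sum_(1 <= k < j.+1) 2 ^+ Delta j k / k%:R ^+ (2 * b + 1) * inner_sum bs' k
  else eps j.

Definition blocks (w : seq nat) (b : nat) (bs : seq nat) : seq nat :=
  nseq b 2%N ++ flatten [seq 1%N :: nseq b' 2%N | b' <- bs] ++ w.

Lemma star_sum_two n s (x : nat -> R) :
  (forall j, (0 < j)%N -> star_sum j s = \sum_(1 <= k < j.+1) binratio j k * x k) ->
  star_sum n (2%N :: s) = \sum_(1 <= k < n.+1) binratio n k * (x k / k%:R ^+ 2).
Proof.
move=> Hs; rewrite /=.
transitivity (\sum_(1 <= j < n.+1) \sum_(1 <= k < j.+1) (j%:R ^+ 2)^-1 * (binratio j k * x k)).
  by apply: eq_big_nat => j /andP[j0 _]; rewrite Hs// mulr_sumr.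
rewrite exchange_triangle; apply: eq_big_nat => k /andP[k0 kn].
transitivity (x k * \sum_(1 <= j < n.+1) binratio j k / j%:R ^+ 2); last first.
  by rewrite sum_binratio_sqr//; ring.
rewrite mulr_sumr [RHS](big_cat_nat (n := k))//=; last exact: ltnW.
rewrite [X in _ = X + _]big1_seq ?add0r.
  by apply: eq_bigr => j _; ring.
by move=> j /andP[_]; rewrite mem_index_iota => /andP[_ jk]; rewrite binratio_eq0// mul0r mulr0.
Qed.

(** The image of [c_n(k)] is supported on the [m >= k] with weight [1 / m] at
[m = k] and [2 / m] beyond; reading this at fixed [m] gives
[2 ^ Delta m k / m]. *)
Lemma star_sum_one n s (x : nat -> R) :
  (forall j, (0 < j)%N -> star_sum j s = \sum_(1 <= k < j.+1) binratio j k * x k) ->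
  star_sum n (1%N :: s) = \sum_(1 <= k < n.+1)
    binratio n k * ((\sum_(1 <= j < k.+1) 2 ^+ Delta k j * x j) / k%:R).
Proof.
move=> Hs; rewrite /=.
transitivity (\sum_(1 <= j < n.+1) \sum_(1 <= k < j.+1) j%:R^-1 * (binratio j k * x k)).
  by apply: eq_big_nat => j /andP[j0 _]; rewrite Hs// mulr_sumr expr1.
rewrite exchange_triangle.
transitivity (\sum_(1 <= k < n.+1) \sum_(k <= m < n.+1)
   binratio n m * (2 ^+ Delta m k * x k / m%:R)).
  apply: eq_big_nat => k /andP[k0 kn].
  transitivity (x k * \sum_(1 <= j < n.+1) binratio j k / j%:R).
    rewrite mulr_sumr [RHS](big_cat_nat (n := k))//=; last exact: ltnW.
    rewrite [X in _ = X + _]big1_seq ?add0r.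
      by apply: eq_bigr => j _; ring.
    by move=> j /andP[_]; rewrite mem_index_iota => /andP[_ jk]; rewrite binratio_eq0// mul0r mulr0.
  rewrite sum_binratio_inv [RHS]big_ltn // mulrDr; congr (_ + _).
    by rewrite /Delta eqxx expr0; ring.
  rewrite mulrA mulr_sumr; apply: eq_big_nat => m /andP[km _].
  by rewrite /Delta gtn_eqF// expr1; ring.
rewrite -exchange_triangle; apply: eq_big_nat => k /andP[k0 kn].
by rewrite mulr_suml mulr_sumr.
Qed.

(** Induction on the word from the right: a block of 2s multiplies the
coefficient of [c_n(k)] by a power of [1 / k^2], and the letter 1 in front of a
block adds one summation. *)
Lemma star_sum_blocks w b bs n :
  (forall j, (0 < j)%N ->
     star_sum j w = \sum_(1 <= k < j.+1) binratio j k * (2 / k%:R * eps k)) ->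
  (0 < n)%N -> star_sum n (blocks w b bs) =
  \sum_(1 <= k < n.+1) binratio n k * (2 / k%:R ^+ (2 * b + 1) * inner_sum bs k).
Proof.
move=> Hw; elim: bs b n => [|b' bs IHbs] b n n0.
  elim: b n n0 => [|b IH] n n0; first by rewrite Hw.
  rewrite [LHS](star_sum_two n (IH)); apply: eq_big_nat => k /andP[k0 kn].
  rewrite mulnS -addnA [k%:R ^+ (2 + _)]exprD [(_ * _)^-1]invfM.
  by set q := _ ^- (2 * b + 1); ring.
elim: b n n0 => [|b IH] n n0.
  have -> : blocks w 0 (b' :: bs) = 1%N :: blocks w b' bs by rewrite /blocks /= catA.
  rewrite [LHS](star_sum_one n (IHbs b')); apply: eq_big_nat => k /andP[k0 kn].
  congr (_ * _) => /=; rewrite mulr_suml mulr_sumr; apply: eq_bigr => j _.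
  by rewrite muln0 add0n expr1; ring.
rewrite [LHS](star_sum_two n (IH)); apply: eq_big_nat => k /andP[k0 kn].
rewrite mulnS -addnA [k%:R ^+ (2 + _)]exprD [(_ * _)^-1]invfM.
by set q := _ ^- (2 * b + 1); set p := inner_sum _ _; ring.
Qed.

End FiniteIdentity.

Section Bases.
Variable R : realType.

Lemma star_sum_nil_expansion n : (0 < n)%N ->
  star_sum R n [::] = \sum_(1 <= k < n.+1) binratio R n k * (2 / k%:R * - ((-1) ^+ k * k%:R)).
Proof.
move=> n0; rewrite [LHS]/= -[LHS]opprK -[X in - X](sum_alt_binratio R n0).
rewrite mulr_sumr -sumrN; apply: eq_big_nat => k /andP[k0 _].
have k1 : k%:R != 0 :> R by rewrite pnatr_eq0; lia.
by field.
Qed.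

Lemma star_sum_one_expansion n : (0 < n)%N ->
  star_sum R n [:: 1%N] = \sum_(1 <= k < n.+1) binratio R n k * (2 / k%:R * 1).
Proof.
move=> n0 /=; have := sum_binratio_inv R n 0.
rewrite invr0 mulr0 add0r => h; transitivity (\sum_(1 <= j < n.+1) binratio R j 0 / j%:R).
  by apply: eq_bigr => k _; rewrite expr1 /=; ring.
by rewrite h mulr_sumr; apply: eq_bigr => k _; ring.
Qed.
End Bases.

(** * Unordered sums *)

Section HasSum.
Context {K : numFieldType}.

Definition has_sum {I : choiceType} (P : pred I) (f : I -> K) (s : K) : Prop :=
  finite_sums P f @ summability.totally --> s.

Lemma has_sum_usum {I : choiceType} (P : pred I) (f : I -> K) s :
  has_sum P f s -> usummable P f /\ usum P f = s.
Proof.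
move=> fs; split; first by apply/cvg_ex; exists s.
have FF := @summability.totally_filter I.
apply: cvg_lim fs; exact: norm_hausdorff.
Qed.

Lemma big_fset_uniq {I : choiceType} (P : pred I) (f : I -> K) (s : seq I) :
  uniq s -> \sum_(i <- [fset x in s]%fset | P i) f i = \sum_(i <- s | P i) f i.
Proof.
move=> us; apply: perm_big; apply: uniq_perm => //.
by move=> i; rewrite inE.
Qed.

(** Duplicate-free sequences replace finite sets, which makes the concrete
enumerations below directly usable. *)
Lemma has_sumP {I : choiceType} (P : pred I) (f : I -> K) s :
  has_sum P f s <->
  forall e, 0 < e -> exists A0 : seq I, forall A : seq I, uniq A ->
    {subset A0 <= A} -> `|s - \sum_(i <- A | P i) f i| <= e.
Proof.
have FF := @summability.totally_filter I.
rewrite /has_sum; split=> [/cvgrPdist_le h e e0|h].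
  have [A0 _ hA] := h e e0; exists A0 => A uA sA.
  have /= := hA [fset x in A]%fset; rewrite /finite_sums big_fset_uniq//.
  by apply; apply/fsubsetP => x xA0; rewrite inE; exact: sA.
apply/cvgrPdist_le => e /h[A0 hA]; exists [fset x in A0]%fset => // A /= sA.
apply: hA => // x xA0; apply: (fsubsetP sA); by rewrite inE.
Qed.

Lemma eq_has_sum {I : choiceType} (P : pred I) (f g : I -> K) s :
  (forall i, P i -> f i = g i) -> has_sum P f s -> has_sum P g s.
Proof.
move=> fg /has_sumP h; apply/has_sumP => e /h[A0 hA]; exists A0 => A uA sA.
by rewrite -(eq_bigr _ fg); exact: hA.
Qed.

Lemma has_sumD {I : choiceType} (P : pred I) (f g : I -> K) s t :
  has_sum P f s -> has_sum P g t -> has_sum P (fun i => f i + g i) (s + t).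
Proof.
move=> fs gt; have FF := @summability.totally_filter I.
rewrite /has_sum (_ : finite_sums P _ = finite_sums P f \+ finite_sums P g).
  exact: cvgD fs gt.
by apply/funext => A; rewrite /finite_sums big_split.
Qed.

Lemma has_sumMl (c : K) {I : choiceType} (P : pred I) (f : I -> K) s :
  has_sum P f s -> has_sum P (fun i => c * f i) (c * s).
Proof.
move=> fs; have FF := @summability.totally_filter I.
rewrite /has_sum (_ : finite_sums P _ = (fun A => c * finite_sums P f A)).
  exact: cvgMr fs.
by apply/funext => A; rewrite /finite_sums mulr_sumr.
Qed.

Lemma has_sumN {I : choiceType} (P : pred I) (f : I -> K) s :
  has_sum P f s -> has_sum P (fun i => - f i) (- s).
Proof.
move=> /(has_sumMl (c := -1)); rewrite mulN1r; apply: eq_has_sum => i _.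
by rewrite mulN1r.
Qed.

Lemma has_sum_bij {I J : choiceType} (P : pred I) (f : I -> K) (h : J -> I) g s :
  cancel h g -> cancel g h -> has_sum P f s -> has_sum (P \o h) (f \o h) s.
Proof.
move=> hg gh /has_sumP H; apply/has_sumP => e /H[A0 hA].
exists (map g A0) => A uA sA; rewrite -(big_map h P f); apply: hA.
  by rewrite map_inj_uniq//; exact: can_inj hg.
move=> i iA0; apply/mapP; exists (g i); rewrite ?gh//.
by apply: sA; exact: map_f.
Qed.

Lemma cvg_sum_seq {T : Type} (F : set_system T) {FF : Filter F} (J : eqType) (A : seq J)
  (P : pred J) (u : J -> T -> K) (l : J -> K) :
  (forall j, j \in A -> P j -> u j @ F --> l j) ->
  (fun t => \sum_(j <- A | P j) u j t) @ F --> \sum_(j <- A | P j) l j.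
Proof.
elim: A => [|j A IH] h.
  rewrite big_nil; rewrite (_ : (fun _ => _) = cst 0); first exact: cvg_cst.
  by apply/funext => t; rewrite big_nil.
rewrite big_cons; case: ifPn => Pj; last first.
  under eq_fun do rewrite big_cons (negbTE Pj).
  by apply: IH => k kA; apply: h; rewrite inE kA orbT.
under eq_fun do rewrite big_cons Pj.
apply: cvgD; first by apply: h; rewrite ?inE ?eqxx.
by apply: IH => k kA; apply: h; rewrite inE kA orbT.
Qed.

(** A finite sum of the [g i] is a limit of sums of [f] over finite rectangles,
and these are close to [s] as soon as the rectangle covers a large enough finite
set. *)
Lemma has_sum_fubini {I J : choiceType} (P : pred I) (Q : pred J)
    (f : I * J -> K) (g : I -> K) s :
  has_sum (fun p => P p.1 && Q p.2) f s ->
  (forall i, P i -> has_sum Q (fun j => f (i, j)) (g i)) ->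
  has_sum P g s.
Proof.
move=> /has_sumP fs fg; apply/has_sumP => e e0.
have e20 : 0 < e / 2 by rewrite divr_gt0.
have [A0 hA0] := fs _ e20; exists (map fst A0) => A uA sA.
have FF := @summability.totally_filter J.
have : (fun C => \sum_(i <- A | P i) finite_sums Q (fun j => f (i, j)) C)
    @ summability.totally --> \sum_(i <- A | P i) g i.
  by apply: cvg_sum_seq => i _; exact: fg.
move=> /cvgrPdist_le /(_ _ e20)[C0 _ hC].
pose C := (C0 `|` [fset x in map snd A0])%fset.
have {hC} /= hC := hC C (fsubsetUl _ _).
have := hA0 [seq (i, j) | i <- A, j <- C].
have -> : \sum_(p <- [seq (i, j) | i <- A, j <- C] | P p.1 && Q p.2) f p =
    \sum_(i <- A | P i) finite_sums Q (fun j => f (i, j)) C.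
  rewrite big_mkcond big_allpairs_dep /= [RHS]big_mkcond.
  apply: eq_bigr => i _; case: (P i) => /=; last by rewrite big1.
  by rewrite /finite_sums [RHS]big_mkcond.
move=> h.
have {h} : `|s - \sum_(i <- A | P i) finite_sums Q (fun j => f (i, j)) C| <= e / 2.
  apply: h => [|[i j] ijA0]; first by apply: allpairs_uniq => // -[? ?] [? ?].
  apply/allpairsP; exists (i, j); split => //=.
    by apply: sA; apply/mapP; exists (i, j).
  by rewrite /C !inE; apply/orP; right; apply/mapP; exists (i, j).
move=> h; rewrite distrC in hC.
rewrite (splitr e) (le_trans _ (lerD h hC))// (le_trans _ (ler_normD _ _))//.
by rewrite addrA subrK.
Qed.

End HasSum.

Lemma ler_sum_subset {I : eqType} {K : numDomainType} (f : I -> K) (s t : seq I) :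
  uniq s -> uniq t -> {subset s <= t} -> {in t, forall x, 0 <= f x} ->
  \sum_(x <- s) f x <= \sum_(x <- t) f x.
Proof.
move=> us ut st f0; rewrite [leRHS](bigID (mem s)) /= -[X in _ <= X + _]big_filter.
rewrite [X in _ <= X + _](perm_big s) /=; last first.
  apply: uniq_perm; rewrite ?filter_uniq// => x; rewrite mem_filter.
  by apply/andP/idP => [[]//|xs]; split=> //; exact: st.
by rewrite lerDl big_seq_cond sumr_ge0// => x /andP[/f0].
Qed.

Lemma normc_real (R : rcfType) (x : R) : `|x%:C| = `|x|%:C :> R[i].
Proof. by rewrite normc_def /= expr0n addr0 sqrtr_sqr. Qed.

Lemma has_sum_real_complex (R : realType) {I : choiceType} (P : pred I) (f : I -> R) s :
  has_sum P f s -> has_sum P (fun x => (f x)%:C) (s%:C).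
Proof.
move=> /has_sumP fs; apply/has_sumP => e; rewrite ltcE /= => /andP[/eqP Ie0 e0].
have [A0 hA0] := fs _ e0; exists A0 => A uA sA.
rewrite -rmorph_sum -rmorphB normc_real lecE /= Ie0 eqxx.
exact: hA0.
Qed.

Section Exhaustion.
Context {I : choiceType} (P : pred I) (rk : I -> nat) (E : nat -> seq I).

(** Asking for the sublevel sets of a rank, rather than for any increasing
sequence of finite sets, makes it immediate that each finite part of [P] is
eventually contained in [E n] and that products of exhaustions are
exhaustions. *)
Definition exhausts : Prop :=
  forall n, uniq (E n) /\ forall x, (x \in E n) = P x && (rk x <= n)%N.

Hypothesis EP : exhausts.

Lemma exhausts_bound (A : seq I) :
  exists N, forall n, (N <= n)%N -> {in A, forall x, P x -> x \in E n}.
Proof.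
exists (\max_(x <- A) rk x)%N => n Nn x xA Px.
rewrite (EP n).2 Px (leq_trans _ Nn)//.
by rewrite (big_rem x)//= leq_maxl.
Qed.

Lemma big_exhausts {V : nmodType} (A : seq I) (f : I -> V) n :
  uniq A -> {subset E n <= A} -> {in A, forall x, P x -> x \in E n} ->
  \sum_(x <- A | P x) f x = \sum_(x <- E n) f x.
Proof.
move=> uA EA AE; rewrite -big_filter; apply: perm_big.
apply: uniq_perm; rewrite ?filter_uniq ?(EP n).1// => x.
rewrite mem_filter; apply/andP/idP => [[Px xA]|xE]; first exact: AE.
by split; [move: xE; rewrite (EP n).2 => /andP[]|exact: EA].
Qed.

Lemma has_sum_cvg {K : numFieldType} (f : I -> K) s :
  has_sum P f s -> (fun n => \sum_(x <- E n) f x) @ \oo --> s.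
Proof.
move=> /has_sumP fs; apply/cvgrPdist_le => e /fs[A0 hA0].
have [N hN] := exhausts_bound A0; exists N => // n /= Nn.
rewrite -(@big_exhausts _ (undup (A0 ++ E n))).
- apply: hA0; rewrite ?undup_uniq// => x xA.
  by rewrite mem_undup mem_cat xA.
- exact: undup_uniq.
- by move=> x xE; rewrite mem_undup mem_cat xE orbT.
move=> x; rewrite mem_undup mem_cat => /orP[xA|//]; exact: hN Nn _ xA.
Qed.

Lemma exhausts_split {V : nmodType} (f : I -> V) n m : (n <= m)%N ->
  \sum_(x <- E m) f x = \sum_(x <- E n) f x + \sum_(x <- E m | x \notin E n) f x.
Proof.
move=> nm; rewrite (bigID (mem (E n))) /=; congr (_ + _).
rewrite -big_filter; apply: perm_big.
apply: uniq_perm; rewrite ?filter_uniq ?(EP _).1// => x.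
rewrite mem_filter !(EP _).2; case: (P x) => //=.
by apply/andP/idP => [[]//|xn]; rewrite xn (leq_trans xn).
Qed.

Lemma exhausts_le {K : numDomainType} (f : I -> K) n m : (n <= m)%N ->
  (forall x, P x -> 0 <= f x) ->
  \sum_(x <- E n) f x <= \sum_(x <- E m) f x.
Proof.
move=> nm f0; apply: ler_sum_subset; rewrite ?(EP _).1// => x; rewrite !(EP _).2.
  by move=> /andP[-> /leq_trans]; exact.
by move=> /andP[/f0].
Qed.

Lemma finite_sum_le {K : numDomainType} (f : I -> K) (A : seq I) n :
  uniq A -> {in A, forall x, P x -> x \in E n} -> (forall x, P x -> 0 <= f x) ->
  \sum_(x <- A | P x) f x <= \sum_(x <- E n) f x.
Proof.
move=> uA AE f0; rewrite -big_filter.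
apply: ler_sum_subset; rewrite ?filter_uniq ?(EP _).1// => x.
  by rewrite mem_filter => /andP[Px /AE]; exact.
by rewrite (EP _).2 => /andP[/f0].
Qed.

Variable R : realType.

Lemma has_sum_nonneg (f : I -> R) (M : R) :
  (forall x, P x -> 0 <= f x) -> (forall n, \sum_(x <- E n) f x <= M) ->
  exists s, has_sum P f s.
Proof.
move=> f0 fM; pose u n := \sum_(x <- E n) f x.
have ndu : {homo u : n m / (n <= m)%N >-> n <= m}.
  by move=> n m nm; exact: exhausts_le.
have ubu : has_ubound (range u) by exists M => _ [n _ <-]; exact: fM.
have cu := nondecreasing_cvgn ndu ubu.
have us n : u n <= sup (range u) by apply: ub_le_sup => //; exists n.
exists (sup (range u)); apply/has_sumP => e e0.
have /cvgrPdist_le /(_ _ e0)[N _ /(_ _ (leqnn N)) /= hN] := cu.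
exists (E N) => A uA sA.
have [m /(_ _ (leqnn m)) hm] := exhausts_bound A.
have Am : \sum_(x <- A | P x) f x <= u m by exact: finite_sum_le.
have AN : u N <= \sum_(x <- A | P x) f x.
  rewrite /u -[leRHS]big_filter; apply: ler_sum_subset; rewrite ?filter_uniq ?(EP _).1// => x.
    by move=> xE; rewrite mem_filter sA// andbT; move: xE; rewrite (EP _).2 => /andP[].
  by rewrite mem_filter => /andP[/f0].
move: hN; rewrite !ger0_norm ?subr_ge0//.
  by apply: le_trans; rewrite lerD2l lerN2.
exact: le_trans Am (us _).
Qed.

Lemma has_sum_abs (f : I -> R) (M : R) :
  (forall n, \sum_(x <- E n) `|f x| <= M) -> exists s, has_sum P f s.
Proof.
move=> fM; have [s hs] := has_sum_nonneg (fun x _ => normr_ge0 (f x)) fM.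
have [| |t ht] := @has_sum_nonneg (fun x => f x + `|f x|) (M + M).
- by move=> x _; have := ler_norm (- f x); rewrite normrN; lra.
- move=> n; rewrite big_split lerD//= (le_trans _ (fM n))// ler_sum// => x _.
  exact: ler_norm.
exists (t - s); have := has_sumD ht (has_sumN hs); apply: eq_has_sum => x _.
by rewrite addrK.
Qed.

(** Dominated convergence for sums truncated at [E n]: the part of the error
inside a fixed [E N] tends to 0 term by term, and the part outside [E N] is at
most the tail of the sum of the [`|f x|]. *)
Lemma tannery (f : I -> R) (M : R) (c : nat -> I -> R) (s : R) :
  (forall n, \sum_(x <- E n) `|f x| <= M) ->
  (forall n x, 0 <= c n x <= 1) -> (forall x, P x -> (c ^~ x) @ \oo --> (1 : R)) ->
  has_sum P f s -> (fun n => \sum_(x <- E n) c n x * f x) @ \oo --> s.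
Proof.
move=> fM c01 c1 fs.
have -> : (fun n => \sum_(x <- E n) c n x * f x) =
  (fun n => \sum_(x <- E n) f x) \- (fun n => \sum_(x <- E n) (1 - c n x) * f x).
  by apply/funext => n /=; rewrite -sumrB; apply: eq_bigr => x _; ring.
rewrite -[s in _ --> s]subr0; apply: cvgB; first exact: has_sum_cvg.
apply/cvgrPdist_le => e e0.
have e20 : 0 < e / 2 by rewrite divr_gt0.
(* The tail is a difference of two partial sums, each within e / 4 of the
limit. *)
have [t /has_sum_cvg /cvgrPdist_le] := has_sum_nonneg (fun x _ => normr_ge0 (f x)) fM.
move=> /(_ (e / 4)); rewrite divr_gt0// => /(_ isT)[N _ hN].
have : (fun n => \sum_(x <- E N) (1 - c n x) * `|f x|) @ \oo -->
   \sum_(x <- E N) 0 * `|f x|.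
  rewrite big_seq; under eq_fun do rewrite big_seq.
  apply: cvg_sum_seq => x _ xE; apply: cvgM; last exact: cvg_cst.
  rewrite -(subrr 1); apply: cvgB; first exact: cvg_cst.
  by apply: c1; move: xE; rewrite (EP _).2 => /andP[].
under eq_bigr do rewrite mul0r.
rewrite big1// => /cvgrPdist_le /(_ _ e20)[N' _ hN'].
exists (maxn N N') => // n /=; rewrite geq_max => /andP[Nn N'n].
rewrite sub0r normrN (le_trans (ler_norm_sum _ _ _))//.
rewrite (eq_bigr (fun x => (1 - c n x) * `|f x|)); last first.
  move=> x _; rewrite normrM ger0_norm// subr_ge0; by case/andP: (c01 n x).
rewrite (exhausts_split _ Nn) (splitr e) lerD//.
  have := hN' n N'n; rewrite /= sub0r normrN; apply: le_trans; exact: ler_norm.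
apply: (@le_trans _ _ (\sum_(x <- E n | x \notin E N) `|f x|)).
  apply: ler_sum => x _; rewrite ler_piMl// gerBl; by case/andP: (c01 n x).
have /= := hN n Nn; have /= := hN N (leqnn N).
rewrite (exhausts_split (fun x => `|f x|) Nn).
set u := \sum_(x <- E N) _; set v := \sum_(x <- E n | _) _.
rewrite !ler_norml => /andP[h1 h2] /andP[h3 h4]; lra.
Qed.

Lemma esum_exhausts (f : I -> R) (s : R) :
  (forall x, P x -> 0 <= f x) -> (fun n => \sum_(x <- E n) f x) @ \oo --> s ->
  \esum_(x in [set x | P x]) (f x)%:E = s%:E.
Proof.
move=> f0 fs; apply/eqP; rewrite eq_le; apply/andP; split.
  apply: ge_ereal_sup => _ [A [finA AP] <-].
  rewrite fsbig_finite//= sumEFin lee_fin.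
  have [N hN] := exhausts_bound (fset_set A).
  apply: (cvgr_to_ge fs); exists N => // n /= Nn.
  apply: ler_sum_subset; rewrite ?(EP _).1// => x.
    rewrite in_fset_set// inE => xA; apply: (hN n Nn); last exact: AP.
    by rewrite in_fset_set// inE.
  by rewrite (EP _).2 => /andP[/f0].
have Efs : (fun n => (\sum_(x <- E n) f x)%:E) @ \oo --> s%:E.
  by apply: cvg_EFin => //; exact: nearW.
apply: (cvge_to_le Efs); apply: nearW => n; apply: esum_ge; exists [set` E n].
  split; first exact: finite_seq.
  by move=> x /=; rewrite (EP _).2 => /andP[].
by rewrite -fsbig_seq ?(EP _).1// sumEFin.
Qed.


(** The imaginary part of [f x] is minus the real part of [f x * 'i], so the
real case applied twice suffices. *)
Lemma has_sum_complex (f : I -> R[i]) (M : R[i]) :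
  (forall n, \sum_(x <- E n) `|f x| <= M) -> exists s, has_sum P f s.
Proof.
have reM (g : I -> R[i]) : (forall n, \sum_(x <- E n) `|g x| <= M) ->
    exists s, has_sum P (fun x => (complex.Re (g x))%:C) s.
  move=> gM; have [n|s hs] := @has_sum_abs (fun x => complex.Re (g x)) (complex.Re M).
    have : (\sum_(x <- E n) `|complex.Re (g x)|)%:C <= M.
      rewrite rmorph_sum (le_trans _ (gM n))//; apply: ler_sum => x _.
      exact: normc_ge_Re.
    by rewrite lecE => /andP[].
  by exists s%:C; exact: has_sum_real_complex.
move=> fM; have [s hs] := reM f fM.
have [|t ht] := reM (fun x => f x * 'i%C).
  move=> n; rewrite (le_trans _ (fM n))//; apply: ler_sum => x _.
  by rewrite normrM complexiE normCi mulr1.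
exists (s + - 'i%C * t); have := has_sumD hs (has_sumMl (c := - 'i%C) ht).
apply: eq_has_sum => x _; rewrite [in RHS](complexE (f x)) ReiNIm rmorphN.
by rewrite mulrNN.
Qed.

End Exhaustion.

(** * Enumerating chains and boxes of tuples *)

Fixpoint chains (n m : nat) : seq (m.-tuple nat) :=
  if m is m'.+1 then
    [seq [tuple of k :: l] | k : nat <- index_iota 1 n.+1, l : m'.-tuple nat <- chains k m']
  else [:: [tuple]].

Fixpoint boxes (n m : nat) : seq (m.-tuple nat) :=
  if m is m'.+1 then
    [seq [tuple of k :: l] | k : nat <- index_iota 0 n.+1, l : m'.-tuple nat <- boxes n m']
  else [:: [tuple]].

Lemma cons_tuple_inj (T : Type) m (x y : T) (s t : m.-tuple T) :
  [tuple of x :: s] = [tuple of y :: t] -> x = y /\ s = t.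
Proof. by move=> /(congr1 val) /= [-> st]; split=> //; exact: val_inj. Qed.

Lemma uniq_cons_allpairs (T : eqType) m (s : seq T) (t : T -> seq (m.-tuple T)) :
  uniq s -> (forall x, uniq (t x)) ->
  uniq [seq [tuple of x :: l] | x : T <- s, l : m.-tuple T <- t x].
Proof.
move=> us ut; apply: allpairs_uniq_dep => //.
by move=> [x l] [y l'] _ _ /= h; have [/= -> ->] := cons_tuple_inj h.
Qed.

Lemma mem_cons_allpairs (T : eqType) m (s : seq T) (t : T -> seq (m.-tuple T)) x
    (l : m.-tuple T) :
  ([tuple of x :: l] \in [seq [tuple of x :: l] | x : T <- s, l : m.-tuple T <- t x]) =
  (x \in s) && (l \in t x).
Proof.
apply/allpairsPdep/andP => [[y [l' [ys ly h]]]|[xs lt]]; last by exists x, l.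
by have [-> ->] := cons_tuple_inj h.
Qed.

Lemma chains_exhausts m :
  exhausts (fun k : m.-tuple nat => pos_chain k) (fun k => head 0%N k) (chains ^~ m).
Proof.
move=> n; split.
  elim: m n => [//|m IH] n; apply: uniq_cons_allpairs; first exact: iota_uniq.
  by move=> k; exact: IH.
elim: m n => [|m IH] n x; first by rewrite (tuple0 x).
case/tupleP: x => x l.
rewrite mem_cons_allpairs IH mem_index_iota ltnS /pos_chain /=.
case: l => [[|y l] _] /=; first by rewrite !andbT.
case: (leq x n); rewrite ?andbF ?andbT //=.
case: (0 < x)%N; rewrite ?andbF ?andbT //=.
case: (path geq y l); rewrite ?andbF ?andbT //=.
by rewrite andbC.
Qed.

Lemma boxes_exhausts m :
  exhausts (xpredT : pred (m.-tuple nat)) (fun k => foldr maxn 0%N k) (boxes ^~ m).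
Proof.
move=> n; split.
  elim: m => [//|m IH]; apply: uniq_cons_allpairs; first exact: iota_uniq.
  by move=> k; exact: IH.
elim: m => [|m IH] x; first by rewrite (tuple0 x).
case/tupleP: x => x l.
by rewrite mem_cons_allpairs IH mem_index_iota ltnS /= geq_max.
Qed.

Lemma pairs_exhausts (I J : choiceType) P Q rkI rkJ (E : nat -> seq I) (F : nat -> seq J) :
  exhausts P rkI E -> exhausts Q rkJ F ->
  exhausts (fun p : I * J => P p.1 && Q p.2) (fun p => maxn (rkI p.1) (rkJ p.2))
    (fun n => [seq (i, j) | i <- E n, j <- F n]).
Proof.
move=> hE hF n; split.
  by apply: allpairs_uniq; rewrite ?(hE n).1 ?(hF n).1// => -[? ?] [? ?].
move=> [i j]; transitivity ((i \in E n) && (j \in F n)).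
  by apply/allpairsP/andP => [[[? ?] /= [? ? [-> ->]]]|[? ?]]; [|exists (i, j)].
by rewrite (hE n).2 (hF n).2 /= geq_max; case: (P i); case: (Q j); rewrite /= ?andbF.
Qed.

Section TupleSums.
Variable K : comRingType.

Lemma big_chainsS n m (G : m.+1.-tuple nat -> K) :
  \sum_(k <- chains n m.+1) G k =
  \sum_(1 <= k < n.+1) \sum_(l <- chains k m) G [tuple of k :: l].
Proof. by rewrite /= big_allpairs_dep. Qed.

Lemma big_boxesS n m (G : m.+1.-tuple nat -> K) :
  \sum_(k <- boxes n m.+1) G k =
  \sum_(0 <= k < n.+1) \sum_(l <- boxes n m) G [tuple of k :: l].
Proof. exact: big_allpairs_dep. Qed.

Lemma big_boxes_prod n m (F : 'I_m -> nat -> K) :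
  \sum_(a <- boxes n m) \prod_(i < m) F i (tnth a i) =
  \prod_(i < m) \sum_(k < n.+1) F i k.
Proof.
elim: m F => [|m IH] F; first by rewrite big_seq1 !big_ord0.
rewrite big_boxesS big_ord_recl -(IH (fun i => F (lift ord0 i))) big_mkord mulr_suml.
apply: eq_bigr => k _; rewrite mulr_sumr; apply: eq_bigr => l _.
rewrite big_ord_recl tnth0; congr (_ * _); apply: eq_bigr => i _.
by rewrite tnthS.
Qed.

End TupleSums.

Section RealTerms.
Variable R : realType.

Lemma sum_chains_star_sum n s :
  \sum_(k <- chains n (size s))
    \prod_(i < size s) ((tnth k i)%:R ^+ nth 0%N s i)^-1 = star_sum R n s.
Proof.
elim: s n => [|x s IH] n; first by rewrite big_seq1 big_ord0.
rewrite [size _]/= big_chainsS [RHS]/=; apply: eq_bigr => k _.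
rewrite -IH mulr_sumr; apply: eq_bigr => l _.
rewrite big_ord_recl tnth0; congr (_ * _); apply: eq_bigr => i _.
by rewrite tnthS.
Qed.

Lemma zeta_star_cvg s (L : R) :
  (fun n => star_sum R n s) @ \oo --> L -> zeta_star R s = L.
Proof.
move=> sL; rewrite /zeta_star.
rewrite (esum_exhausts (@chains_exhausts (size s)) (s := L))//.
  by move=> k _; apply: prodr_ge0 => i _; rewrite invr_ge0 exprn_ge0.
by under eq_fun do rewrite sum_chains_star_sum.
Qed.

(** This is the coefficient of [\prod_i z_i ^ (2 * a_i)] in the kernel, except
that the entry [p] preceding the chain is left free, for induction on the
length. *)
Definition kernel_coef m (p : nat) (a k : m.-tuple nat) : R :=
  \prod_(i < m) ((tnth k i)%:R * 2 ^+ Delta (nth 0%N (p :: k) i) (tnth k i)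
    / (tnth k i)%:R ^+ (2 * tnth a i + 2)).

Lemma kernel_coef_cons m p b k (a l : m.-tuple nat) :
  kernel_coef p [tuple of b :: a] [tuple of k :: l] =
  k%:R * 2 ^+ Delta p k / k%:R ^+ (2 * b + 2) * kernel_coef k a l.
Proof.
rewrite /kernel_coef big_ord_recl !tnth0 /=; congr (_ * _).
by apply: eq_bigr => i _; rewrite !tnthS /=.
Qed.

Variable eps : nat -> R.

Definition chain_term m (a k : m.-tuple nat) : R :=
  eps (last 0%N k) / (head 0%N k)%:R ^+ 2 * kernel_coef 0 a k.

(** The bound [n] of the chains also serves as the preceding entry, as in the
recursion that defines [inner_sum]. *)
Lemma inner_sumE m (a : m.-tuple nat) n :
  \sum_(k <- chains n m) eps (last n k) * kernel_coef n a k = inner_sum eps a n.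
Proof.
elim: m a n => [|m IH] a n.
  by rewrite (tuple0 a) big_seq1 /kernel_coef big_ord0 mulr1.
case/tupleP: a => b a; rewrite big_chainsS /=.
apply: eq_big_nat => k /andP[k0 kn].
rewrite -IH mulr_sumr; apply: eq_bigr => l _.
rewrite kernel_coef_cons /= addnS [_ ^+ (2 * b + 1).+1]exprS [(_ * _)^-1]invfM.
have k1 : k%:R != 0 :> R by rewrite pnatr_eq0; lia.
set q := _ ^- (2 * b + 1); set c := kernel_coef _ _ _.
by field.
Qed.

(** A first entry [k > 0] differs from the entry 0 before it, hence the
factor 2 on the right. *)
Lemma sum_binratio_term n b m (bs : m.-tuple nat) :
  \sum_(k <- chains n m.+1) binratio R n (head 0%N k) * chain_term [tuple of b :: bs] k =
  \sum_(1 <= k < n.+1) binratio R n k * (2 / k%:R ^+ (2 * b.+1 + 1) * inner_sum eps bs k).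
Proof.
rewrite big_chainsS; apply: eq_big_nat => k /andP[k0 kn].
rewrite -inner_sumE !mulr_sumr; apply: eq_bigr => l _.
rewrite /chain_term kernel_coef_cons /=; congr (_ * _).
rewrite /Delta ltn_eqF// expr1.
rewrite (_ : (2 * b.+1 + 1 = (2 * b + 2).+1)%N); last by lia.
rewrite [_ ^+ (2 * b + 2).+1]exprS [(_ * _ ^+ _)^-1]invfM.
have k1 : k%:R != 0 :> R by rewrite pnatr_eq0; lia.
set q := _ ^- (2 * b + 2); set c := kernel_coef _ _ _; set e := eps _.
by field.
Qed.

(** The family that dominates everything; its sum is elementary because the
last entry in the numerator makes the inner summations telescope. *)
Definition majorant m (k : m.-tuple nat) : R :=
  (last 0%N k)%:R / (head 0%N k)%:R ^+ 2 * \prod_(i < m) (tnth k i)%:R^-1.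

(** Summing over the last entry [k_m <= k_(m-1)] the quotient
[k_m / k_m = 1] gives [k_(m-1)], which cancels the next denominator, and so
on. *)
Lemma sum_chains_last_inv n m :
  \sum_(k <- chains n m) (last n k)%:R * \prod_(i < m) (tnth k i)%:R^-1 = n%:R :> R.
Proof.
elim: m n => [|m IH] n; first by rewrite big_seq1 big_ord0 mulr1.
transitivity (\sum_(1 <= k < n.+1) (1 : R)); last by rewrite sumr_const_nat subSS subn0.
rewrite big_chainsS; apply: eq_big_nat => k /andP[k0 _].
transitivity (k%:R^-1 * k%:R : R); last by rewrite mulVf// pnatr_eq0 -lt0n.
rewrite -[X in _ = _ * X](IH k) mulr_sumr.
apply: eq_bigr => l _; rewrite big_ord_recl tnth0 mulrCA; congr (_ * (_ * _)).
by apply: eq_bigr => i _; rewrite tnthS.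
Qed.

Lemma sum_inv_sqr_le2 n : \sum_(1 <= k < n.+1) (k%:R ^+ 2)^-1 <= 2 :> R.
Proof.
case: n => [|n]; first by rewrite big_nil.
suff : \sum_(1 <= k < n.+2) (k%:R ^+ 2)^-1 <= 2 - n.+1%:R^-1 :> R.
  by move=> h; rewrite (le_trans h)// gerBl invr_ge0.
elim: n => [|n IH]; first by rewrite big_nat1 expr1n invr1; lra.
rewrite big_nat_recr//= (le_trans (lerD IH (lexx _)))// -[n.+2%:R]natr1.
have x0 : 0 < n.+1%:R :> R by rewrite ltr0n.
set x := n.+1%:R in x0 *; rewrite -subr_ge0.
have -> : 2 - (x + 1)^-1 - (2 - x^-1 + ((x + 1) ^+ 2)^-1) = (x * (x + 1) ^+ 2)^-1.
  by field; rewrite !gt_eqF ?ltr_wpDr.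
by rewrite invr_ge0 mulr_ge0 ?exprn_ge0 ?addr_ge0// ltW.
Qed.

Lemma sum_majorant_le2 n m : \sum_(k <- chains n m.+1) majorant k <= 2.
Proof.
apply: le_trans (sum_inv_sqr_le2 n); rewrite big_chainsS le_eqVlt; apply/orP; left.
apply/eqP; apply: eq_big_nat => k /andP[k0 _].
transitivity ((k%:R ^+ 2)^-1 * (k%:R^-1 * k%:R) : R); last first.
  by rewrite mulVf ?mulr1// pnatr_eq0 -lt0n.
rewrite -[X in _ = _ * (_ * X)](sum_chains_last_inv k m) !mulr_sumr.
apply: eq_bigr => l _; rewrite /majorant big_ord_recl tnth0 /=.
under eq_bigr do rewrite tnthS.
by rewrite [RHS]mulrCA mulrCA; ring.
Qed.

Hypothesis eps_le : forall k, `|eps k| <= k%:R.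

Lemma chain_term_le m (a k : m.-tuple nat) : pos_chain k ->
  `|chain_term a k| <= 2 ^+ m * majorant k.
Proof.
move=> /andP[_ /allP k1].
have -> : 2 ^+ m * majorant k = (last 0%N k)%:R / (head 0%N k)%:R ^+ 2 *
    \prod_(i < m) (2 / (tnth k i)%:R).
  by rewrite big_split /= prodr_const card_ord /majorant; ring.
rewrite /chain_term !normrM normr_prod ler_pM ?mulr_ge0//.
- by apply: prodr_ge0.
- by rewrite ler_pM// ger0_norm// invr_ge0 exprn_ge0.
apply: ler_prod => i _; rewrite normr_ge0 /=.
have ki : (0 < tnth k i)%N by apply: k1; exact: mem_tnth.
have ki0 : (tnth k i)%:R != 0 :> R by rewrite pnatr_eq0 -lt0n.
rewrite ger0_norm; last by rewrite divr_ge0 ?exprn_ge0 ?mulr_ge0 ?exprn_ge0.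
set x := _%:R in ki0 *; set y := 2 ^+ Delta _ _; set n := (2 * tnth a i)%N.
have -> : x * y / x ^+ (n + 2) = y * (x^-1 * (x ^+ n)^-1).
  by rewrite exprD; field; rewrite ki0 expf_neq0.
have x1 : 1 <= x by rewrite ler1n.
have xn : 0 <= x ^+ n by rewrite exprn_ge0.
rewrite ler_pM ?mulr_ge0 ?invr_ge0 ?exprn_ge0//.
  by rewrite /y /Delta; case: eqP => _; rewrite ?expr0 ?expr1// ler1n.
by rewrite ler_piMr ?invr_ge0// invf_le1 ?exprn_ege1// exprn_gt0// ltr0n.
Qed.

End RealTerms.

(** * Limits and generating functions *)

Lemma binratio_cvg (R : realType) k : binratio R ^~ k @ \oo --> (1 : R).
Proof.
rewrite -(cvg_shiftS (binratio R ^~ k)).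
apply: (@squeeze_cvgr _ _ _ _ (fun n => 1 - k%:R ^+ 2 * harmonic n) (cst 1)).
- by apply: nearW => n /=; rewrite binratio_ge binratio_le1.
- rewrite -[X in _ --> X]subr0 -[X in _ - X](mulr0 (k%:R ^+ 2)).
  apply: cvgB; first exact: cvg_cst.
  by apply: cvgMr; exact: cvg_harmonic.
exact: cvg_cst.
Qed.

Lemma sum_geometric (K : fieldType) (x : K) n :
  x != 1 -> \sum_(k < n) x ^+ k = (1 - x ^+ n) / (1 - x).
Proof.
move=> x1; have x0 : 1 - x != 0 by rewrite subr_eq0 eq_sym.
by rewrite -[1 - x ^+ n]opprB subrX1 -mulNr opprB mulrC mulKf.
Qed.

Lemma sum_geometric_le (K : numFieldType) (r : K) n :
  0 <= r < 1 -> \sum_(k < n) r ^+ k <= (1 - r)^-1.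
Proof.
move=> /andP[r0 r1]; rewrite sum_geometric ?lt_eqF// ler_piMl//.
  by rewrite invr_ge0 subr_ge0 ltW.
by rewrite gerBl exprn_ge0.
Qed.

Lemma cvg_prod_ord (K : numFieldType) m (u : 'I_m -> nat -> K) (l : 'I_m -> K) :
  (forall i, u i @ \oo --> l i) ->
  (fun n => \prod_(i < m) u i n) @ \oo --> \prod_(i < m) l i.
Proof.
elim: m u l => [|m IH] u l ul.
  rewrite big_ord0; under eq_fun do rewrite big_ord0; exact: cvg_cst.
rewrite big_ord_recl; under eq_fun do rewrite big_ord_recl.
apply: cvgM => //; apply: IH => i; exact: ul.
Qed.

Lemma cvg_geometric_sum (K : numFieldType) (x : K) :
  x != 1 -> (fun n => x ^+ n) @ \oo --> (0 : K) ->
  (fun n => \sum_(k < n.+1) x ^+ k) @ \oo --> (1 - x)^-1.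
Proof.
move=> x1 x0.
have -> : (fun n => \sum_(k < n.+1) x ^+ k) = (fun n => (1 - x ^+ n.+1) / (1 - x)).
  by apply/funext => n; rewrite sum_geometric.
rewrite -[X in _ --> X]mul1r; apply: cvgM; last exact: cvg_cst.
rewrite -[X in _ --> X]subr0; apply: cvgB; first exact: cvg_cst.
by rewrite (cvg_shiftS (fun n => x ^+ n)).
Qed.

Lemma cvg_seqP (K : numFieldType) (u : nat -> K) (l : K) :
  (forall e, 0 < e -> exists N, forall n, (N <= n)%N -> `|l - u n| <= e) ->
  u @ \oo --> l.
Proof. by move=> h; apply/cvgrPdist_le => e /h[N hN]; exists N. Qed.

Section Complex.
Variable R : realType.

Lemma cvg_expr_complex (x : R[i]) :
  `|x| < 1 -> (fun n => x ^+ n) @ \oo --> (0 : (R[i] : numFieldType)).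
Proof.
move=> x1; apply: cvg_seqP => e; rewrite ltcE /= => /andP[/eqP Ie0 e0].
have [r rE] : exists r : R, `|x| = r%:C.
  by exists (complex.Re `|x|); rewrite RRe_real// normr_real.
have r0 : 0 <= r by rewrite -ler0c -rE.
have r1 : `|r| < 1 by rewrite ger0_norm// -ltcR -rE.
have /cvgrPdist_le /(_ _ e0)[N _ hN] := cvg_expr r1.
exists N => n /hN; rewrite /= !sub0r !normrN => h.
by rewrite normrX rE -rmorphXn lecE /= Ie0 eqxx (le_trans (ler_norm _)).
Qed.

(** Partial sums over boxes factor into one-variable geometric sums, which gives
both the bound and the value. *)
Lemma has_sum_prod_geometric m (x : 'I_m -> R[i]) : (forall i, `|x i| < 1) ->
  has_sum xpredT (fun a : m.-tuple nat => \prod_(i < m) x i ^+ tnth a i)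
    (\prod_(i < m) (1 - x i)^-1).
Proof.
move=> x1; have [n|s hs] := has_sum_complex (@boxes_exhausts m)
  (f := fun a : m.-tuple nat => \prod_(i < m) x i ^+ tnth a i)
  (M := \prod_(i < m) (1 - `|x i|)^-1).
  under eq_bigr do [rewrite normr_prod; under eq_bigr do rewrite normrX].
  rewrite (big_boxes_prod n (fun i k => `|x i| ^+ k)).
  by apply: ler_prod => i _; rewrite sumr_ge0 ?sum_geometric_le ?normr_ge0 ?x1.
suff <- : s = \prod_(i < m) (1 - x i)^-1 by [].
have x1' i : x i != 1.
  by apply: contraTneq (x1 i) => ->; rewrite normr1 ltxx.
have := has_sum_cvg (@boxes_exhausts m) hs.
under eq_fun do rewrite (big_boxes_prod _ (fun i k => x i ^+ k)).
move=> /cvg_unique; apply; first exact: norm_hausdorff.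
apply: cvg_prod_ord => i.
by apply: cvg_geometric_sum => //; exact: cvg_expr_complex.
Qed.

Variables (w : seq nat) (eps : nat -> R).
Hypothesis w_expansion : forall n, (0 < n)%N ->
  star_sum R n w = \sum_(1 <= k < n.+1) binratio R n k * (2 / k%:R * eps k).
Hypothesis eps_le : forall k, `|eps k| <= k%:R.

(** The truncated sum is [star_sum] when weighted by [c_n(k_0)], so it tends to
[zeta_star] on one side and, by dominated convergence, to the unweighted sum
on the other. *)
Lemma has_sum_term m (a : m.+1.-tuple nat) :
  has_sum (fun k : m.+1.-tuple nat => pos_chain k) (chain_term eps a)
    (zeta_star R (blocks w (thead a).+1 (behead a))).
Proof.
have bnd n : \sum_(k <- chains n m.+1) `|chain_term eps a k| <= 2 ^+ m.+1 * 2.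
  apply: (@le_trans _ _ (\sum_(k <- chains n m.+1) 2 ^+ m.+1 * majorant R k)).
    rewrite big_seq [leRHS]big_seq; apply: ler_sum => k kn; apply: chain_term_le => //.
    by move: kn; rewrite (@chains_exhausts m.+1 n).2 => /andP[].
  by rewrite -mulr_sumr ler_wpM2l ?exprn_ge0 ?sum_majorant_le2.
have [s hs] := has_sum_abs (@chains_exhausts m.+1) bnd.
rewrite (zeta_star_cvg (L := s))//.
have : (fun n => \sum_(k <- chains n m.+1) binratio R n (head 0%N k) * chain_term eps a k)
    @ \oo --> s.
  apply: (tannery (@chains_exhausts m.+1) bnd) => //.
  - by move=> n k; rewrite binratio_ge0 binratio_le1.
  - move=> k _; exact: binratio_cvg.
case/tupleP: a {bnd hs} => b bs; rewrite theadE.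
under eq_fun do rewrite sum_binratio_term.
rewrite -cvg_shiftS -[X in _ -> X]cvg_shiftS => h.
under eq_fun do rewrite (star_sum_blocks _ _ w_expansion)//.
exact: h.
Qed.

Section GeneratingFunction.
Variables (m : nat) (z : 'I_m.+1 -> R[i]).
Hypothesis z_lt1 : forall j, `|z j| < 1.

(** The double family whose two iterated sums are the two sides. *)
Let cell (p : m.+1.-tuple nat * m.+1.-tuple nat) : R[i] :=
  (\prod_(j < m.+1) z j ^+ (2 * tnth p.1 j)) * (chain_term eps p.1 p.2)%:C.

(** The bound [`|z j| ^ (2 * a_j) <= `|z j| ^ a_j] decouples [a] from [k]: the
dominating family is a product of a function of [a] and a function of [k]. *)
Lemma cell_summable : exists s,
  has_sum (fun p : m.+1.-tuple nat * m.+1.-tuple nat => xpredT p.1 && pos_chain p.2) cell s.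
Proof.
apply: (has_sum_complex (pairs_exhausts (@boxes_exhausts m.+1) (@chains_exhausts m.+1))
  (M := (\prod_(j < m.+1) (1 - `|z j|)^-1) * (2 ^+ m.+1 * 2)%:C)) => n.
rewrite big_allpairs.
apply: (@le_trans _ _ (\sum_(a <- boxes n m.+1) \sum_(k <- chains n m.+1)
   (\prod_(j < m.+1) `|z j| ^+ tnth a j) * (2 ^+ m.+1 * majorant R k)%:C)).
  apply: ler_sum => a _; rewrite big_seq [leRHS]big_seq; apply: ler_sum => k kn.
  rewrite /cell normrM ler_pM//=.
    rewrite normr_prod; apply: ler_prod => j _; rewrite normr_ge0 /= normrX.
    by rewrite ler_wiXn2l // ?ltW// leq_pmull.
  rewrite normc_real lecR; apply: chain_term_le => //.
  by move: kn; rewrite (@chains_exhausts m.+1 n).2 => /andP[].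
under eq_bigr do rewrite -mulr_sumr.
rewrite -mulr_suml (big_boxes_prod n (fun j k => `|z j| ^+ k)) ler_pM//.
- by apply: prodr_ge0 => j _; apply: sumr_ge0 => k _; rewrite exprn_ge0.
- apply: sumr_ge0 => k _; rewrite ler0c mulr_ge0 ?exprn_ge0// /majorant.
  by rewrite !mulr_ge0 ?invr_ge0 ?exprn_ge0 ?prodr_ge0.
- by apply: ler_prod => j _; rewrite sumr_ge0 ?sum_geometric_le ?normr_ge0 ?z_lt1.
rewrite -rmorph_sum lecR -mulr_sumr ler_wpM2l ?exprn_ge0//.
exact: sum_majorant_le2.
Qed.

(** For fixed [k] the sum is a product of geometric series of ratios
[z_i^2 / k_i^2]. *)
Lemma has_sum_cell_left (k : m.+1.-tuple nat) : pos_chain k ->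
  has_sum xpredT (fun a => cell (a, k))
   ((eps (last 0%N k))%:C / (head 0%N k)%:R ^+ 2 * kernel_prod z k).
Proof.
move=> /andP[_ /allP k1].
have k0 i : (tnth k i)%:R != 0 :> R[i].
  by rewrite pnatr_eq0 -lt0n; apply: k1; exact: mem_tnth.
pose x i := z i ^+ 2 / (tnth k i)%:R ^+ 2.
pose y i := (tnth k i)%:R * 2 ^+ Delta (nth 0%N (0%N :: k) i) (tnth k i)
    / (tnth k i)%:R ^+ 2 : R[i].
have x1 i : `|x i| < 1.
  rewrite /x normrM normfV !normrX normr_nat.
  have ki : (0 < tnth k i)%N by apply: k1; exact: mem_tnth.
  have kp : 0 < (tnth k i)%:R ^+ 2 :> R[i] by rewrite exprn_gt0// ltr0n.
  rewrite ltr_pdivrMr// mul1r.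
  apply: (@lt_le_trans _ _ 1); first by rewrite expr_lt1.
  by rewrite exprn_ege1// ler1n.
pose C := (eps (last 0%N k))%:C / (head 0%N k)%:R ^+ 2 * \prod_(i < m.+1) y i.
have := has_sumMl (c := C) (has_sum_prod_geometric x1).
have -> : C * \prod_(i < m.+1) (1 - x i)^-1 =
    (eps (last 0%N k))%:C / (head 0%N k)%:R ^+ 2 * kernel_prod z k.
  rewrite /C -mulrA -big_split /=; congr (_ * _); apply: eq_bigr => i _.
  have zk : (tnth k i)%:R ^+ 2 - z i ^+ 2 != 0.
    rewrite subr_eq0; apply: contraTneq (x1 i) => zk.
    by rewrite /x -zk mulfV ?expf_neq0// normr1 ltxx.
  by rewrite /x /y; field; rewrite k0 zk.
apply: eq_has_sum => a _; rewrite /cell /chain_term /C /kernel_coef /=.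
rewrite rmorphM fmorph_div rmorphXn rmorph_nat rmorph_prod mulrC.
rewrite [LHS]mulrCA [RHS]mulrCA; congr (_ * _); rewrite -!big_split; apply: eq_bigr => i _ /=.
rewrite fmorph_div rmorphM !rmorphXn !rmorph_nat /x /y expr_div_n -!exprM.
by rewrite [in RHS]addnC exprD; field; rewrite k0 expf_neq0.
Qed.

Lemma has_sum_cell_right (a : m.+1.-tuple nat) :
  has_sum (fun k : m.+1.-tuple nat => pos_chain k) (fun k => cell (a, k))
    ((zeta_star R (blocks w (thead a).+1 (behead a)))%:C
      * \prod_(j < m.+1) z j ^+ (2 * tnth a j)).
Proof. by rewrite mulrC; apply: has_sumMl; apply: has_sum_real_complex; exact: has_sum_term. Qed.

Lemma generating_function : exists s,
  has_sum xpredT (fun a : m.+1.-tuple nat =>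
      (zeta_star R (blocks w (thead a).+1 (behead a)))%:C
        * \prod_(j < m.+1) z j ^+ (2 * tnth a j)) s /\
  has_sum (fun k : m.+1.-tuple nat => pos_chain k) (fun k =>
      (eps (last 0%N k))%:C / (head 0%N k)%:R ^+ 2 * kernel_prod z k) s.
Proof.
have [s hs] := cell_summable; exists s; split.
  by apply: (has_sum_fubini hs) => a _; exact: has_sum_cell_right.
pose swap (p : m.+1.-tuple nat * m.+1.-tuple nat) := (p.2, p.1).
have swapK : cancel swap swap by case.
have {}hs := has_sum_bij swapK swapK hs.
apply: (@has_sum_fubini _ _ _ _ xpredT (cell \o swap)); last exact: has_sum_cell_left.
rewrite (_ : (fun p => _) =
  (fun p : m.+1.-tuple nat * m.+1.-tuple nat => xpredT p.1 && pos_chain p.2) \o swap) //.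
by apply/funext => p /=; rewrite andbT.
Qed.

End GeneratingFunction.
End Complex.

Theorem theorem1p2 (R : realType) (d : nat) (z : 'I_d.+1 -> R[i])
    (hz : forall j : 'I_d.+1, `|z j| < 1) :
  let lhs1 := fun a : d.+1.-tuple nat =>
    (zeta_star R (two_one_word a))%:C
      * \prod_(j < d.+1) z j ^+ (2 * tnth a j) in
  let rhs1 := fun k : d.+1.-tuple nat =>
    (-1) ^+ tnth k ord_max * (tnth k ord_max)%:R / (tnth k ord0)%:R ^+ 2
      * kernel_prod z k in
  let lhs2 := fun a : d.+1.-tuple nat =>
    (zeta_star R (rcons (two_one_word a) 1%N))%:C
      * \prod_(j < d.+1) z j ^+ (2 * tnth a j) in
  let rhs2 := fun k : d.+1.-tuple nat =>
    1 / (tnth k ord0)%:R ^+ 2 * kernel_prod z k in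
  let chain := fun k : d.+1.-tuple nat => pos_chain k in
  [/\ usummable xpredT lhs1, usummable chain rhs1
    & usum xpredT lhs1 = - usum chain rhs1] /\
  [/\ usummable xpredT lhs2, usummable chain rhs2
    & usum xpredT lhs2 = usum chain rhs2].
Proof.
move=> lhs1 rhs1 lhs2 rhs2 chain.
have headE (k : d.+1.-tuple nat) : head 0%N k = tnth k ord0.
  by rewrite (tnth_nth 0%N) nth0.
have lastE (k : d.+1.-tuple nat) : last 0%N k = tnth k ord_max.
  by rewrite (tnth_nth 0%N) -nth_last size_tuple.
split.
  have eps_le (k : nat) : `|- ((-1) ^+ k * k%:R : R)| <= k%:R.
    by rewrite normrN normrM normrX normrN1 expr1n mul1r normr_nat.
  have [s [hl hr]] := generating_function (@star_sum_nil_expansion R) eps_le hz.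
  have {}hl : has_sum xpredT lhs1 s.
    by apply: eq_has_sum hl => a _; rewrite /lhs1 /two_one_word /blocks cats0.
  have {}hr : has_sum chain rhs1 (- s).
    apply: eq_has_sum (has_sumN hr) => k _; rewrite /rhs1 lastE headE.
    by rewrite rmorphN rmorphM rmorphXn rmorphN1 rmorph_nat !mulNr opprK.
  have [cl ->] := has_sum_usum hl; have [cr ->] := has_sum_usum hr.
  by split=> //; rewrite opprK.
(* The value at 0 is forced by the bound on eps; entries of chains are positive. *)
pose eps (k : nat) : R := (0 < k)%N%:R.
have eps_le k : `|eps k| <= k%:R by rewrite normr_nat ler_nat; case: k.
have expansion n : (0 < n)%N -> star_sum R n [:: 1%N] =
    \sum_(1 <= k < n.+1) binratio R n k * (2 / k%:R * eps k).
  move=> n0; rewrite star_sum_one_expansion//; apply: eq_big_nat => k /andP[k0 _].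
  by rewrite /eps k0.
have [s [hl hr]] := generating_function expansion eps_le hz.
have {}hl : has_sum xpredT lhs2 s.
  apply: eq_has_sum hl => a _; rewrite /lhs2 /two_one_word /blocks.
  by rewrite -cats1 -catA.
have {}hr : has_sum chain rhs2 s.
  apply: eq_has_sum hr => k /andP[_ /allP k1]; rewrite /rhs2 lastE headE /eps.
  by rewrite k1 ?mem_tnth.
have [cl ->] := has_sum_usum hl; have [cr ->] := has_sum_usum hr.
by [].
Qed.
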